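(* Let $n,m\ge1$, let $G=SU(n,m)$ and $K=S(U(n)\times U(m))$, and let $f$ be the Guichardet–Wigner two-cocycle on $G$, $$f(g_1,g_2)=\frac1{2\pi}\arg\big(v(g_1)v(g_2)v(g_1g_2)^{-1}\big),\qquad v\begin{pmatrix}a&b\\c&d\end{pmatrix}=\det a .$$ For complex $n\times m$ matrices $Z_1,Z_2$ with $\mathbf 1_n-Z_iZ_i^+>0$, let $g_i=\sigma(Z_i)\in G$ be the elements defined in the context, and let $$e^{i\Phi}=\det\left[(\mathbf 1+Z_1Z_2^+)(\mathbf 1+Z_2Z_1^+)^{-1}\right]^{1/2}$$ be the multiplicative factor on $G/K$ (defined in the context). Then the multiplicative factor is the two-cocycle $f$ expressed in the Pontrjagin coordinates $Z_1,Z_2$, namely $$e^{i\Phi}=e^{-2\pi i f(g_1,g_2)} .$$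
   Context: Notation: $Z^+$ is the conjugate transpose, $\mathbf 1$ an identity matrix of the appropriate size. $SU(n,m)$ is the group of determinant-one matrices $U$ with $U^+IU=I$, $I=\mathrm{diag}(-\mathbf 1_n,\mathbf 1_m)$; its elements are written in blocks $\begin{pmatrix}a&b\\c&d\end{pmatrix}$ with $a$ of size $n\times n$ and $d$ of size $m\times m$ (the block $a$ is always invertible). Pontrjagin coordinates identify $G/K$ with $\{Z\in M_{n\times m}(\mathbb C):\mathbf 1-ZZ^+>0\}$ via $gK\mapsto bd^{-1}$. The section $\sigma:G/K\to G$ is $$\sigma(Z)=\begin{pmatrix}(\mathbf 1-ZZ^+)^{-1/2}&Z(\mathbf 1-Z^+Z)^{-1/2}\\(\mathbf 1-Z^+Z)^{-1/2}Z^+&(\mathbf 1-Z^+Z)^{-1/2}\end{pmatrix}.$$ In $f$, $\arg$ denotes the continuous determination on $G\times G$ that vanishes at $(e,e)$. Multiplicative factor: let $\pi$ be an irreducible unitary representation of $G$ with minimal weight vector $e_0$ on which block diagonal elements $\mathrm{diag}(A,D)\in K$ act by $\det A$. Then $e^{i\Phi}$ is the scalar with $\pi(\sigma(Z_1)\sigma(Z_2))e_0=e^{i\Phi}\pi(\sigma(Z_3))e_0$, where $Z_3$ is the Pontrjagin coordinate of $\sigma(Z_1)\sigma(Z_2)K$; its value is the formula in the claim. There, with $w=\det(\mathbf 1+Z_1Z_2^+)\ne0$, one has $\det(\mathbf 1+Z_2Z_1^+)=\bar w$ and the half-power means $(w/\bar w)^{1/2}=w/|w|$. *)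

(* Defs.v *)
From HB Require Import structures.
From mathcomp Require Import all_boot all_order all_algebra.
From mathcomp Require Export sesquilinear spectral.
From mathcomp Require Export complex.
From mathcomp Require Import all_classical all_reals all_analysis.

Set Implicit Arguments.
Unset Strict Implicit.
Unset Printing Implicit Defensive.

Import Order.TTheory GRing.Theory Num.Theory.
Import numFieldNormedType.Exports.

Local Open Scope classical_set_scope.
Local Open Scope ring_scope.
Local Open Scope sesquilinear_scope.
Local Open Scope complex_scope.

(* The topology of R[i] given by its modulus. *)
#[export, non_forgetful_inheritance]
HB.instance Definition _ (R : realType) := PseudoPointedMetric.copy R[i] R[i]^o.

Section Defs.
Variable R : realType.
Local Notation C := R[i].

Definition expi (t : R) : C := cos t +i* sin t.

(* In the order of R[i], [0 < x] entails that x is real, so this condition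
   already forces A to be Hermitian. *)
Definition posdefmx n (A : 'M[C]_n) : Prop :=
  forall x : 'rV[C]_n, x != 0 -> 0 < (x *m A *m x^t*) 0 0.

(* A^(-1/2) by functional calculus; meaningful for positive definite A, where
   [spectral_diag A] lists the (positive) eigenvalues of A in the orthonormal
   eigenbasis [spectralmx A]. *)
Definition invsqrtmx n (A : 'M[C]_n) : 'M[C]_n :=
  invmx (spectralmx A) *m
    diag_mx (map_mx (fun x : C => (sqrtC x)^-1) (spectral_diag A)) *m
  spectralmx A.

Definition sigmx n m (Z : 'M[C]_(n, m)) : 'M[C]_(n + m) :=
  let S := invsqrtmx (1%:M - Z^t* *m Z) in
  block_mx (invsqrtmx (1%:M - Z *m Z^t*)) (Z *m S)
           (S *m Z^t*)                    S.

Variables n m : nat.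

Definition Inm : 'M[C]_(n + m) := block_mx (- 1%:M) 0 0 1%:M.

Definition SU : set 'M[C]_(n + m) :=
  [set U | U^t* *m Inm *m U = Inm /\ \det U = 1].

Definition vdet (g : 'M[C]_(n + m)) : C := \det (ulsubmx g).

(* theta is a determination on G x G of arg (v(g1) v(g2) v(g1 g2)^-1), continuous
   for the topology induced by that of pairs of matrices, and zero at (e, e). *)
Definition is_continuous_arg
    (theta : 'M[C]_(n + m) * 'M[C]_(n + m) -> R) : Prop :=
  [/\ {within SU `*` SU, continuous theta},
      theta (1%:M, 1%:M) = 0 &
      forall g1 g2, SU g1 -> SU g2 ->
        let u := vdet g1 * vdet g2 * (vdet (g1 *m g2))^-1 in
        u = `|u| * expi (theta (g1, g2))].

(* [xget] selects a function satisfying [is_continuous_arg] if there is one, and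
   the zero function otherwise. As G is connected, the restriction of such a
   function to G x G is unique; its values elsewhere are irrelevant. *)
Definition continuous_arg : 'M[C]_(n + m) * 'M[C]_(n + m) -> R :=
  xget (fun=> 0) is_continuous_arg.

Definition GW_cocycle (g1 g2 : 'M[C]_(n + m)) : R :=
  (2 * pi)^-1 * continuous_arg (g1, g2).

(* e^{i Phi} = det[(1 + Z1 Z2^+) (1 + Z2 Z1^+)^-1]^(1/2): the half-power is the
   determination (w / w^* )^(1/2) = w / |w| with w = det (1 + Z1 Z2^+);
   see [mult_factor_sqr]. *)
Definition mult_factor (Z1 Z2 : 'M[C]_(n, m)) : C :=
  let w := \det (1%:M + Z1 *m Z2^t*) in w / `|w|.

Lemma mult_factor_sqr (Z1 Z2 : 'M[C]_(n, m)) :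
  mult_factor Z1 Z2 ^+ 2 =
  \det ((1%:M + Z1 *m Z2^t*) *m invmx (1%:M + Z2 *m Z1^t*)).
Proof.
have -> : 1%:M + Z2 *m Z1^t* = (1%:M + Z1 *m Z2^t*)^t*.
  by rewrite linearD /= map_mxD trmx1 map_mx1 trmx_mul map_mxM /= trmxCK.
rewrite det_mulmx det_inv det_map_mx det_tr /mult_factor /=.
set w := \det _; have [->|w0] := eqVneq w 0; first by rewrite !mul0r expr0n.
rewrite expr_div_n normCK invfM mulrA expr2 mulfK //.
Qed.

End Defs.

(* Main.v *)
(** Write [g1], [g2] in blocks, with first rows [a1 b1], [a2 b2] and lower left
    block [c2] of [g2]. Then [v(g1) v(g2) / v(g1 g2) = 1 / det (1 + W Y)] where
    [W = a1^-1 b1] and [Y = c2 a2^-1], and pseudo-unitarity makes [W] and [Y]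
    strict contractions, so that [A = 1 + W Y] is accretive:
    [Re (x A x^+) > 0] for [x != 0]. Gaussian elimination preserves accretivity,
    so [det A] is a product of pivots lying in the right half-plane; the sum of
    their arctangents depends continuously on [A] and yields the continuous
    determination of the argument on [G x G]. For [g_i = sigma(Z_i)] one finds
    [W = Z1] and [Y = Z2^+], hence the quotient is [1 / det (1 + Z1 Z2^+)]. *)

Require Import Defs.
From mathcomp Require Import all_boot all_order all_algebra.
From mathcomp Require Import all_classical all_reals all_analysis.
From mathcomp Require Import ring.

Set Implicit Arguments.
Unset Strict Implicit.
Unset Printing Implicit Defensive.

Import Order.TTheory GRing.Theory Num.Theory.
Import numFieldNormedType.Exports.

Local Open Scope classical_set_scope.
Local Open Scope ring_scope.
Local Open Scope sesquilinear_scope.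
Local Open Scope complex_scope.

(** * Conjugate transposes and the square norm of row vectors *)

Section ConjugateTranspose.
Variable C : numClosedFieldType.

Lemma adjmxM p q r (A : 'M[C]_(p, q)) (B : 'M[C]_(q, r)) :
  (A *m B)^t* = B^t* *m A^t*.
Proof. by rewrite trmx_mul map_mxM. Qed.

Lemma adjmxD p q (A B : 'M[C]_(p, q)) : (A + B)^t* = A^t* + B^t*.
Proof. by rewrite linearD /= map_mxD. Qed.

Lemma adjmxN p q (A : 'M[C]_(p, q)) : (- A)^t* = - A^t*.
Proof. by rewrite linearN /= map_mxN. Qed.

Lemma adjmx1 p : (1%:M : 'M[C]_p)^t* = 1%:M.
Proof. by rewrite trmx1 map_mx1. Qed.

Lemma adjmx_block p q r s (A : 'M[C]_(p, q)) (B : 'M[C]_(p, r))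
    (D : 'M[C]_(s, q)) (E : 'M[C]_(s, r)) :
  (block_mx A B D E)^t* = block_mx (A^t*) (D^t*) (B^t*) (E^t*).
Proof. by rewrite tr_block_mx map_block_mx. Qed.

Lemma sqnorm_ge0 p (x : 'rV[C]_p) : 0 <= (x *m x^t*) 0 0.
Proof.
by rewrite mxE sumr_ge0 // => i _; rewrite !mxE -normCK exprn_ge0.
Qed.

Lemma sqnorm_gt0 p (x : 'rV[C]_p) : (0 < (x *m x^t*) 0 0) = (x != 0).
Proof.
rewrite lt0r sqnorm_ge0 andbT; congr (~~ _); apply/eqP/eqP => [|->]; last first.
  by rewrite mul0mx mxE.
rewrite mxE => /eqP; rewrite psumr_eq0; last first.
  by move=> i _; rewrite !mxE -normCK exprn_ge0.
move=> /allP xi0; apply/rowP => i; have := xi0 i.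
by rewrite !mxE mem_index_enum -normCK expf_eq0 normr_eq0 => /(_ isT)/eqP.
Qed.

Lemma unitmx_row_inj (F : fieldType) p (A : 'M[F]_p) :
  (forall x : 'rV_p, x *m A = 0 -> x = 0) -> A \in unitmx.
Proof.
move=> Ainj; rewrite -row_free_unit -kermx_eq0; apply/rowV0P => v.
by rewrite sub_kermx => /eqP/Ainj.
Qed.

End ConjugateTranspose.

(** * Inverse square roots of positive definite matrices *)

Section InverseSquareRoot.
Variable R : realType.
Local Notation C := R[i].

(** Completing the square: with [y = x Z^+], the form of [1 - Z^+ Z] at [x] is [|x - y Z|^2] plus
    the form of [1 - Z Z^+] at [y]. The second term is positive unless [y = 0], and then the first
    one is [|x|^2]. *)
Lemma posdef_contraction_adj n m (Z : 'M[C]_(n, m)) :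
  posdefmx (1%:M - Z *m Z^t*) -> posdefmx (1%:M - Z^t* *m Z).
Proof.
move=> Zpos x x0; pose y := x *m Z^t*.
have -> : x *m (1%:M - Z^t* *m Z) *m x^t* =
    (x - y *m Z) *m (x - y *m Z)^t* + y *m (1%:M - Z *m Z^t*) *m y^t*.
  rewrite adjmxD adjmxN /y !(adjmxM, trmxCK).
  rewrite !(mulmxBl, mulmxBr, mulmx1, mul1mx) !mulmxA.
  by rewrite subrK.
rewrite mxE; have [y0|y0] := eqVneq y 0.
  by rewrite y0 !mul0mx subr0 [X in _ + X]mxE addr0 sqnorm_gt0.
by rewrite ltr_wpDl ?sqnorm_ge0 // Zpos.
Qed.

Variables (n : nat) (A : 'M[C]_n).
Hypotheses (A_herm : A^t* = A) (A_pos : posdefmx A).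
Local Notation U := (spectralmx A).
Local Notation d := (spectral_diag A).

Lemma herm_normalmx : A \is normalmx.
Proof. by apply/normalmxP; rewrite A_herm. Qed.

Lemma herm_spectral : A = invmx U *m diag_mx d *m U.
Proof. exact/orthomx_spectralP/herm_normalmx. Qed.

(** The rows of the unitary matrix [U] are unit eigenvectors, so each eigenvalue is the value of the
    quadratic form of [A] at such a row. *)
Lemma posdef_spectral_diag_gt0 i : 0 < d 0 i.
Proof.
pose x := row i U.
have x0 : x != 0.
  apply: contraTneq (spectral_unit A) => x0.
  apply/negP => /mulmxV/row_matrixP/(_ i); rewrite row_mul -/x x0 mul0mx.
  move=> /rowP/(_ i); rewrite !mxE eqxx => /eqP.
  by rewrite eq_sym oner_eq0.
suff -> : d 0 i = (x *m A *m x^t*) 0 0 by exact: A_pos.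
have UU := mulmxV (spectral_unit A).
have -> : x^t* = invmx U *m (delta_mx i 0).
  by rewrite (invmx_unitary (spectral_unitarymx A)) /x rowE adjmxM
       trmx_delta map_delta_mx.
have UA : U *m A = diag_mx d *m U.
  by rewrite [X in U *m X]herm_spectral !mulmxA UU mul1mx.
rewrite /x rowE -(mulmxA _ U A) UA !mulmxA -[_ *m U *m invmx U]mulmxA UU mulmx1.
by rewrite -rowE -colE !mxE eqxx.
Qed.

Let s := map_mx (fun x : C => (sqrtC x)^-1) d.

Let s_gt0 i : 0 < s 0 i.
Proof. by rewrite mxE invr_gt0 sqrtC_gt0 posdef_spectral_diag_gt0. Qed.

Lemma invsqrtmx_herm : (invsqrtmx A)^t* = invsqrtmx A.
Proof.
rewrite /invsqrtmx (invmx_unitary (spectral_unitarymx A)) !adjmxM trmxCK mulmxA.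
congr (_ *m _ *m _); rewrite tr_diag_mx map_diag_mx; congr diag_mx.
by apply/rowP => i; rewrite -/s mxE; apply/CrealP/gtr0_real/s_gt0.
Qed.

Lemma invsqrtmx_mul : invsqrtmx A *m A *m invsqrtmx A = 1%:M.
Proof.
have UU X : invmx U *m diag_mx s *m U *m (invmx U *m X *m U) =
    invmx U *m (diag_mx s *m X) *m U.
  by rewrite !mulmxA (mulmxK (spectral_unit A)).
rewrite (_ : invsqrtmx A *m A = invmx U *m (diag_mx s *m diag_mx d) *m U).
  rewrite /invsqrtmx -/s -!mulmxA (mulKVmx (spectral_unit A)).
  rewrite (mulmxA (diag_mx d)) (mulmxA (diag_mx s)) !mulmx_diag.
  rewrite [X in diag_mx X](_ : _ = const_mx 1).
    by rewrite diag_const_mx mul1mx mulVmx ?spectral_unit.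
  apply/rowP => i; rewrite !mxE.
  have : sqrtC (d 0 i) != 0 by rewrite gt_eqF ?sqrtC_gt0 ?posdef_spectral_diag_gt0.
  by move=> r0; rewrite -{2}(sqrtCK (d 0 i)) expr2; field.
by rewrite -UU -herm_spectral.
Qed.

Lemma invsqrtmx_det_gt0 : 0 < \det (invsqrtmx A).
Proof.
rewrite /invsqrtmx !det_mulmx det_inv mulrAC mulVf ?mul1r; last first.
  by rewrite -unitfE -unitmxE spectral_unit.
by rewrite det_diag prodr_gt0 // => i _; exact: s_gt0.
Qed.

Lemma invsqrtmx_unit : invsqrtmx A \in unitmx.
Proof. by rewrite unitmxE unitfE gt_eqF ?invsqrtmx_det_gt0. Qed.

End InverseSquareRoot.

(** In the two eigenbases the relation [A Z = Z B] reads [d_i M_ij = M_ij e_j]. Wherever [M_ij] is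
    nonzero the eigenvalues [d_i] and [e_j] agree, hence so do the values of any function at
    them. *)
Lemma invsqrtmx_intertwine (R : realType) n m (A : 'M[R[i]]_n) (B : 'M[R[i]]_m)
    (Z : 'M[R[i]]_(n, m)) :
  A^t* = A -> B^t* = B -> A *m Z = Z *m B ->
  invsqrtmx A *m Z = Z *m invsqrtmx B.
Proof.
move=> /herm_spectral EA /herm_spectral EB.
rewrite {1}EA {1}EB /invsqrtmx.
have := spectral_unit A; have := spectral_unit B.
set U := spectralmx A; set V := spectralmx B => Vu Uu.
set d := spectral_diag A; set e := spectral_diag B => AZ.
pose M := U *m Z *m invmx V.
have dM : diag_mx d *m M = M *m diag_mx e.
  rewrite /M; have := congr1 (fun X => U *m X *m invmx V) AZ.
  by rewrite !mulmxA (mulmxV Uu) mul1mx (mulmxK Vu).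
have sM : diag_mx (map_mx (fun x => (sqrtC x)^-1) d) *m M =
          M *m diag_mx (map_mx (fun x => (sqrtC x)^-1) e).
  move: M dM => M dM; apply/matrixP => i j.
  have /matrixP/(_ i j) := dM; rewrite !(mul_diag_mx, mul_mx_diag) !mxE.
  have [->|M0] := eqVneq (M i j) 0; first by rewrite !(mulr0, mul0r).
  by rewrite mulrC => /(mulfI M0) ->; rewrite mulrC.
have := congr1 (fun X => invmx U *m X *m V) sM.
by rewrite /M !mulmxA (mulVmx Uu) mul1mx (mulmxKV Vu).
Qed.

(** * Block relations and contractions in SU(n,m) *)

Section SpecialPseudoUnitaryGroup.
Variables (R : realType) (n m : nat).
Local Notation C := R[i].
Local Notation SU := (@SU R n m).
Local Notation Inm := (@Inm R n m).

Lemma SU1 : SU 1%:M.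
Proof. by split; rewrite ?adjmx1 ?mul1mx ?mulmx1 ?det1. Qed.

Lemma Inm_sqr : Inm *m Inm = 1%:M.
Proof.
rewrite /Inm mulmx_block !(mulmx0, mul0mx, mulmx1, mul1mx, addr0, add0r).
by rewrite mulNmx mulmxN opprK mulmx1 -scalar_mx_block.
Qed.

(** Since [I^2 = 1], the defining relation makes [I g^+ I] a left inverse of [g]. For square
    matrices it is then also a right inverse. *)
Lemma SU_mulmxI (g : 'M[C]_(n + m)) : SU g -> g *m Inm *m g^t* = Inm.
Proof.
move=> [gI _]; have : Inm *m g^t* *m Inm *m g = 1%:M.
  by rewrite -!mulmxA (mulmxA (g^t*)) gI Inm_sqr.
move=> /mulmx1C; rewrite !mulmxA => E.
by rewrite -[LHS]mulmx1 -Inm_sqr mulmxA E mul1mx.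
Qed.

Variable g : 'M[C]_(n + m).
Hypothesis gSU : SU g.

Lemma SU_ul_dl :
  (ulsubmx g)^t* *m ulsubmx g = 1%:M + (dlsubmx g)^t* *m dlsubmx g.
Proof.
have [] := gSU; rewrite -{1 2}[g]submxK adjmx_block /Inm !mulmx_block.
rewrite !(mulmx0, mul0mx, mulmx1, mul1mx, addr0, add0r).
move=> /eq_block_mx[+ _ _ _].
rewrite mulmxN mulNmx mulmx1 => E.
by rewrite -[1%:M]opprK -E opprD opprK subrK.
Qed.

Lemma SU_ul_ur :
  ulsubmx g *m (ulsubmx g)^t* = 1%:M + ursubmx g *m (ursubmx g)^t*.
Proof.
have := SU_mulmxI gSU; rewrite -{1 2}[g]submxK adjmx_block /Inm !mulmx_block.
rewrite !(mulmx0, mul0mx, mulmx1, mul1mx, addr0, add0r).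
move=> /eq_block_mx[+ _ _ _].
rewrite mulmxN mulNmx mulmx1 => E.
by rewrite -[1%:M]opprK -E opprD opprK subrK.
Qed.

(** The matrix [a^+ a = 1 + c^+ c] is positive definite, so no nonzero row vector is annihilated by
    [a^+]. *)
Lemma SU_ul_unit : ulsubmx g \in unitmx.
Proof.
suff : (ulsubmx g)^t* \in unitmx by rewrite map_unitmx unitmx_tr.
apply: unitmx_row_inj => x x0; apply/eqP; rewrite -[_ == _]negbK -sqnorm_gt0.
have := congr1 (fun A => (x *m A *m x^t*) 0 0) SU_ul_dl.
have -> : x *m (1%:M + (dlsubmx g)^t* *m dlsubmx g) *m x^t* =
    x *m x^t* + (x *m (dlsubmx g)^t*) *m (x *m (dlsubmx g)^t*)^t*.
  by rewrite adjmxM trmxCK mulmxDr mulmxDl mulmx1 !mulmxA.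
rewrite mulmxA x0 !mul0mx [LHS]mxE [RHS]mxE => E.
apply/negP => x_gt0; have := ltr_wpDr (sqnorm_ge0 (x *m (dlsubmx g)^t*)) x_gt0.
by rewrite -E ltxx.
Qed.

(** Multiplying [a a^+ - b b^+ = 1] by [a^-1] on the left and by its adjoint on the right gives
    [1 - W W^+ = a^-1 (a^-1)^+] for [W = a^-1 b]. This is positive definite because [a] is
    invertible. *)
Lemma SU_contraction_ur :
  posdefmx (1%:M - (invmx (ulsubmx g) *m ursubmx g) *m
                   (invmx (ulsubmx g) *m ursubmx g)^t*).
Proof.
move=> x x0; set a := ulsubmx g; set b := ursubmx g.
have au : a \in unitmx := SU_ul_unit.
have -> : 1%:M - (invmx a *m b) *m (invmx a *m b)^t* = invmx a *m (invmx a)^t*.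
  rewrite adjmxM mulmxA -(mulmxA (invmx a)).
  have -> : b *m b^t* = a *m a^t* - 1%:M by rewrite SU_ul_ur addrC addKr.
  have a1 : a^t* *m (invmx a)^t* = 1%:M by rewrite -adjmxM mulVmx ?adjmx1.
  by rewrite mulmxBr mulmx1 mulmxBl (mulKmx au) a1 opprB addrC subrK.
have -> : x *m (invmx a *m (invmx a)^t*) *m x^t* =
    (x *m invmx a) *m (x *m invmx a)^t* by rewrite adjmxM !mulmxA.
rewrite sqnorm_gt0; apply: contra x0 => /eqP xa.
by rewrite -[x](mulmxKV au) xa mul0mx.
Qed.

(** The mirror argument, starting from [a^+ a - c^+ c = 1]. *)
Lemma SU_contraction_dl :
  posdefmx (1%:M - (dlsubmx g *m invmx (ulsubmx g))^t* *m
                   (dlsubmx g *m invmx (ulsubmx g))).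
Proof.
move=> x x0; set a := ulsubmx g; set c := dlsubmx g.
have au : a \in unitmx := SU_ul_unit.
have a1 : (invmx a)^t* *m a^t* = 1%:M by rewrite -adjmxM mulmxV ?adjmx1.
have -> : 1%:M - (c *m invmx a)^t* *m (c *m invmx a) = (invmx a)^t* *m invmx a.
  rewrite adjmxM mulmxA -(mulmxA _ (c^t*)).
  have -> : c^t* *m c = a^t* *m a - 1%:M by rewrite SU_ul_dl addrC addKr.
  by rewrite mulmxBr mulmx1 mulmxBl mulmxA a1 mul1mx (mulmxV au) opprB addrC subrK.
have -> : x *m ((invmx a)^t* *m invmx a) *m x^t* =
    (x *m (invmx a)^t*) *m (x *m (invmx a)^t*)^t*.
  by rewrite adjmxM trmxCK !mulmxA.
rewrite sqnorm_gt0; apply: contra x0 => /eqP xa.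
by rewrite -[x]mulmx1 -a1 mulmxA xa mul0mx.
Qed.

End SpecialPseudoUnitaryGroup.

(** * The section sigma takes its values in SU(n,m) *)

(** The intertwining relations cancel the off-diagonal blocks of the product and turn the diagonal
    ones into the two normalizations of [S] and [T]. *)
Lemma block_section_isom (R : realType) n m (Z : 'M[R[i]]_(n, m)) S T :
  S *m Z = Z *m T -> T *m Z^t* = Z^t* *m S ->
  S *m (1%:M - Z *m Z^t*) *m S = 1%:M -> T *m (1%:M - Z^t* *m Z) *m T = 1%:M ->
  block_mx S (S *m Z) (Z^t* *m S) T *m @Inm R n m *m
    block_mx S (S *m Z) (Z^t* *m S) T = @Inm R n m.
Proof.
move=> SZ TZ SAS TBT; rewrite /Inm !mulmx_block.
rewrite !(mulmx0, mul0mx, mulmx1, addr0, add0r, mulmxN, mulNmx) -!mulmxA.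
congr block_mx.
- by rewrite -SAS mulmxBr mulmxBl mulmx1 opprB !mulmxA addrC.
- by rewrite -SZ addNr.
- by rewrite (mulmxA T) TZ -mulmxA addNr.
- by rewrite SZ (mulmxA (Z^t*)) -TZ -TBT mulmxBr mulmxBl mulmx1 !mulmxA addrC.
Qed.

Section PontrjaginSection.
Variables (R : realType) (n m : nat) (Z : 'M[R[i]]_(n, m)).
Hypothesis Zpos : posdefmx (1%:M - Z *m Z^t*).
Let A := 1%:M - Z *m Z^t*.
Let B := 1%:M - Z^t* *m Z.
Let S := invsqrtmx A.
Let T := invsqrtmx B.

Let A_herm : A^t* = A.
Proof. by rewrite /A adjmxD adjmxN adjmx1 adjmxM trmxCK. Qed.

Let B_herm : B^t* = B.
Proof. by rewrite /B adjmxD adjmxN adjmx1 adjmxM trmxCK. Qed.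

Let B_pos : posdefmx B := posdef_contraction_adj Zpos.

Let S_herm : S^t* = S := invsqrtmx_herm A_herm Zpos.
Let T_herm : T^t* = T := invsqrtmx_herm B_herm B_pos.

Let SZ : S *m Z = Z *m T.
Proof.
apply: invsqrtmx_intertwine => //.
by rewrite /A /B mulmxBl mulmxBr mul1mx mulmx1 mulmxA.
Qed.

Let TZ : T *m Z^t* = Z^t* *m S.
Proof. by rewrite -[T]T_herm -adjmxM -SZ adjmxM S_herm. Qed.

(** In this form the upper left block [S] is a left factor of the upper right block and a right
    factor of the lower left one, so that [a^-1 b = Z] and [c a^-1 = Z^+] follow by cancellation. *)
Lemma sigmxE : sigmx Z = block_mx S (S *m Z) (Z^t* *m S) T.
Proof. by rewrite /sigmx -/A -/B -/S -/T -SZ TZ. Qed.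

Let S_unit : S \in unitmx.
Proof. exact: invsqrtmx_unit. Qed.

Lemma sigmx_ulV_ur : invmx (ulsubmx (sigmx Z)) *m ursubmx (sigmx Z) = Z.
Proof.
by rewrite sigmxE block_mxKul block_mxKur mulKmx ?S_unit.
Qed.

Lemma sigmx_dl_ulV : dlsubmx (sigmx Z) *m invmx (ulsubmx (sigmx Z)) = Z^t*.
Proof.
by rewrite sigmxE block_mxKul block_mxKdl mulmxK ?S_unit.
Qed.

Let sigmx_herm : (sigmx Z)^t* = sigmx Z.
Proof.
by rewrite sigmxE adjmx_block S_herm T_herm (adjmxM S) (adjmxM (Z^t*)) S_herm trmxCK.
Qed.

Let sigmx_isom : (sigmx Z)^t* *m @Inm R n m *m sigmx Z = @Inm R n m.
Proof.
rewrite sigmx_herm sigmxE; apply: block_section_isom => //.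
- exact: invsqrtmx_mul.
- exact: invsqrtmx_mul.
Qed.

(** For the Hermitian matrix [sigmx Z], preserving [Inm] only gives that the determinant squares to
    1; positivity excludes the value -1. *)
Let sigmx_det_gt0 : 0 < \det (sigmx Z).
Proof.
have TBT : T *m B *m T = 1%:M := invsqrtmx_mul B_herm B_pos.
(* A unipotent right factor clears the upper right block. The determinant becomes
   [det S * det (B T)], and [det (B T)] is the inverse of [det T > 0]. *)
have : sigmx Z *m block_mx 1%:M (- Z) 0 1%:M = block_mx S 0 (Z^t* *m S) (B *m T).
  rewrite sigmxE mulmx_block !(mulmx0, mulmx1, addr0, mulmxN) addNr.
  by rewrite -(mulmxA (Z^t*)) SZ (mulmxBl _ _ T) mul1mx -(mulmxA (Z^t*)) addrC.
move=> /(congr1 (@determinant _ _)).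
rewrite det_mulmx det_ublock !det1 !mulr1 det_lblock => ->.
rewrite mulr_gt0 //; first exact: invsqrtmx_det_gt0.
have := congr1 (@determinant _ _) TBT; rewrite -mulmxA det_mulmx det1 => E.
by rewrite -(pmulr_rgt0 _ (invsqrtmx_det_gt0 B_herm B_pos)) E ltr01.
Qed.

Lemma sigmx_SU : SU (sigmx Z).
Proof.
split=> //; have := congr1 (@determinant _ _) sigmx_isom.
rewrite sigmx_herm !det_mulmx mulrAC -[RHS]mul1r.
have /(congr1 (@determinant _ _)) := @Inm_sqr R n m.
rewrite det_mulmx det1 => I1 /mulIf E.
have /E/eqP : \det (@Inm R n m) != 0.
  by apply: contra_eq_neq I1 => ->; rewrite mul0r eq_sym oner_eq0.
rewrite -expr2 sqrf_eq1 => /orP[/eqP//|/eqP d1].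
by have := sigmx_det_gt0; rewrite d1 oppr_gt0 ltr10.
Qed.

End PontrjaginSection.

(** * Accretive matrices and the argument of their determinants *)

Section AccretiveArgument.
Variable R : realType.
Local Notation C := R[i].
Local Notation Re := (@complex.Re R).
Local Notation Im := (@complex.Im R).

Lemma expiD (s t : R) : expi (s + t) = expi s * expi t.
Proof.
rewrite /expi; apply/eqP; rewrite eq_complex /= sinD cosD.
by rewrite eqxx /= addrC [sin s * _]mulrC.
Qed.

Lemma expi0 : expi (0 : R) = 1.
Proof. by rewrite /expi cos0 sin0. Qed.

Lemma expiN (t : R) : expi (- t) = (expi t)^-1.
Proof.
have E : expi (- t) * expi t = 1 by rewrite -expiD addNr expi0.
have t0 : expi t != 0 by apply: contra_eq_neq E => ->; rewrite mulr0 eq_sym oner_eq0.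
by rewrite -[LHS](mulfK t0) E mul1r.
Qed.

Definition half_plane_arg (z : C) : R := atan (Im z / Re z).

Lemma half_plane_argP (z : C) : 0 < Re z -> z = `|z| * expi (half_plane_arg z).
Proof.
case: z => a b /= a0; rewrite normc_def /expi /half_plane_arg /=.
have s0 : 0 < Num.sqrt (1 + (b / a) ^+ 2).
  by rewrite sqrtr_gt0 ltr_wpDr ?sqr_ge0.
have c0 : cos (atan (b / a)) != 0 by rewrite cos_atan invr_eq0 gt_eqF.
have -> : sin (atan (b / a)) = b / a * cos (atan (b / a)).
  exact/(canRL (divfK c0))/atanK.
have E : Num.sqrt (a ^+ 2 + b ^+ 2) * cos (atan (b / a)) = a.
  rewrite cos_atan; have -> : a ^+ 2 + b ^+ 2 = a ^+ 2 * (1 + (b / a) ^+ 2).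
    by field; rewrite gt_eqF.
  rewrite sqrtrM ?sqr_ge0 // sqrtr_sqr gtr0_norm // mulfK //.
  by rewrite gt_eqF.
apply/eqP; rewrite eq_complex /= !mul0r subr0 addr0 E eqxx /=.
by rewrite mulrCA E mulfVK // gt_eqF.
Qed.

Definition accretive n (A : 'M[C]_n) : Prop :=
  forall x : 'rV[C]_n, x != 0 -> 0 < Re ((x *m A *m x^t*) 0 0).

Definition schur_complement n (A : 'M[C]_(1 + n)) : 'M[C]_n :=
  drsubmx A - (A 0 0)^-1 *: (dlsubmx A *m ursubmx A).

(** Each pivot contributes an angle in []-pi/2, pi/2[]. The sum is not reduced modulo [2 pi], so it
    stays continuous when [det A] crosses the negative real axis. *)
Fixpoint accretive_arg n : 'M[C]_n -> R :=
  if n is n'.+1 then fun A : 'M[C]_(1 + n') =>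
    half_plane_arg (A 0 0) + accretive_arg (schur_complement A)
  else fun=> 0.

Lemma accretive_pivot n (A : 'M[C]_(1 + n)) : accretive A -> 0 < Re (A 0 0).
Proof.
move=> /(_ (delta_mx 0 0)); have -> : (delta_mx 0 0 : 'rV[C]_(1 + n)) != 0.
  apply/eqP => /matrixP/(_ 0 0)/eqP; rewrite !mxE !eqxx.
  by rewrite oner_eq0.
move=> /(_ isT).
have -> : (delta_mx 0 0 : 'rV[C]_(1 + n))^t* = delta_mx 0 0.
  by rewrite trmx_delta map_delta_mx.
by rewrite -rowE -colE !mxE.
Qed.

Lemma accretive_pivot_neq0 n (A : 'M[C]_(1 + n)) : accretive A -> A 0 0 != 0.
Proof. by move=> /accretive_pivot; apply: contraTneq => ->; rewrite ltxx. Qed.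

Lemma pivot_block n (A : 'M[C]_(1 + n)) :
  A = block_mx (A 0 0)%:M (ursubmx A) (dlsubmx A) (drsubmx A).
Proof.
rewrite -[LHS]submxK; congr block_mx; apply/matrixP => i j.
by rewrite !ord1 !mxE /= mulr1n; congr (A _ _); apply: val_inj.
Qed.

(** One step of Gaussian elimination: a unipotent lower factor times a block upper triangular
    one. *)
Lemma det_schur_complement n (A : 'M[C]_(1 + n)) :
  A 0 0 != 0 -> \det A = A 0 0 * \det (schur_complement A).
Proof.
move=> a0; have AE : A =
    block_mx 1%:M 0 ((A 0 0)^-1 *: dlsubmx A) 1%:M *m
    block_mx (A 0 0)%:M (ursubmx A) 0 (schur_complement A).
  rewrite {1}[A]pivot_block mulmx_block !(mul1mx, mul0mx, addr0, mulmx0).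
  congr block_mx; first by rewrite mul_mx_scalar scalerA mulfV // scale1r.
  by rewrite /schur_complement -scalemxAl addrC subrK.
by rewrite {1}AE det_mulmx det_lblock det_ublock !det1 !mul1r det_scalar expr1.
Qed.

(* With [x = (- y c / a, y)] one has [x A = (0, y S)], hence
   [x A x^+ = y S y^+]. *)
Lemma accretive_schur n (A : 'M[C]_(1 + n)) :
  accretive A -> accretive (schur_complement A).
Proof.
move=> Aacc y y0; have a0 := accretive_pivot_neq0 Aacc.
pose x := row_mx (- (A 0 0)^-1 *: (y *m dlsubmx A)) y.
have x0 : x != 0.
  apply: contra_neq y0 => /(congr1 rsubmx).
  by rewrite row_mxKr linear0.
have xA : x *m A = row_mx 0 (y *m schur_complement A).
  rewrite [A in LHS]pivot_block /x mul_row_block; congr row_mx.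
    by rewrite mul_mx_scalar scalerA mulrN mulfV // scaleN1r addNr.
  rewrite /schur_complement mulmxBr addrC -scalemxAl scaleNr.
  by rewrite -scalemxAr mulmxA.
have := Aacc x x0; rewrite xA /x tr_row_mx map_col_mx mul_row_col mul0mx add0r.
by [].
Qed.

Lemma accretive_argP n (A : 'M[C]_n) :
  accretive A -> \det A = `|\det A| * expi (accretive_arg A).
Proof.
elim: n A => [|n IH] A Aacc.
  by rewrite det_mx00 normr1 expi0 mulr1.
have a0 := accretive_pivot_neq0 Aacc.
rewrite (det_schur_complement a0) /= expiD normrM mulrACA.
by rewrite -half_plane_argP ?accretive_pivot // -IH //; apply: accretive_schur.
Qed.

Lemma accretive_det_neq0 n (A : 'M[C]_n) : accretive A -> \det A != 0.
Proof.
elim: n A => [|n IH] A Aacc; first by rewrite det_mx00 oner_eq0.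
have a0 := accretive_pivot_neq0 Aacc.
by rewrite (det_schur_complement a0) mulf_neq0 // IH //; apply: accretive_schur.
Qed.

Lemma accretive_arg1 n : accretive_arg (1%:M : 'M[C]_n) = 0.
Proof.
elim: n => [//|n IH] /=.
have -> : schur_complement (1%:M : 'M[C]_(1 + n)) = 1%:M.
  rewrite /schur_complement (@scalar_mx_block _ 1 n).
  by rewrite block_mxKdr block_mxKdl mul0mx scaler0 subr0.
by rewrite IH addr0 /half_plane_arg mxE /= mul0r atan0.
Qed.

(** Twice the real part of [x (1 + W Y) x^+] equals [x (1 - W W^+) x^+ + x (1 - Y^+ Y) x^+ + |x W +
    x Y^+|^2]: the first two terms are positive and the square is nonnegative. *)
Lemma accretive_contractions n m (W : 'M[C]_(n, m)) (Y : 'M[C]_(m, n)) :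
  posdefmx (1%:M - W *m W^t*) -> posdefmx (1%:M - Y^t* *m Y) ->
  accretive (1%:M + W *m Y).
Proof.
move=> Wpos Ypos x x0; set z := (x *m _ *m _) 0 0.
have zC : z^*%C = (x *m (1%:M + W *m Y)^t* *m x^t*) 0 0.
  have <- : (x *m (1%:M + W *m Y) *m x^t*)^t* = x *m (1%:M + W *m Y)^t* *m x^t*.
    by rewrite 2!adjmxM trmxCK mulmxA.
  by rewrite /z; move: (x *m _ *m _) => M; rewrite !mxE.
suff : 0 < z + z^*%C.
  by rewrite [z + z^*%C]addcJ pmulr_rgt0 ?ltr0n // ltcR.
have -> : z + z^*%C = (x *m (1%:M - W *m W^t*) *m x^t* +
    x *m (1%:M - Y^t* *m Y) *m x^t* +
    (x *m W + x *m Y^t*) *m (x *m W + x *m Y^t*)^t*) 0 0.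
  rewrite zC /z !adjmxD !adjmxM adjmx1 trmxCK.
  rewrite !(mulmxDl, mulmxDr, mulmxN, mulNmx, mulmx1) !mulmxA.
  move: (x *m x^t*) (x *m W *m Y *m _) (x *m Y^t* *m W^t* *m _).
  move: (x *m W *m W^t* *m _) (x *m Y^t* *m Y *m _) => a b c d e.
  by rewrite !mxE; ring.
rewrite [ltRHS]mxE [X in X + _]mxE ltr_wpDr ?sqnorm_ge0 //.
exact: addr_gt0 (Wpos x x0) (Ypos x x0).
Qed.

End AccretiveArgument.

(* Unlike [invmx], this involves no test for invertibility. *)
Definition cramer_inv (K : fieldType) p (A : 'M[K]_p) : 'M[K]_p :=
  (\det A)^-1 *: \adj A.

Lemma cramer_invE (K : fieldType) p (A : 'M[K]_p) :
  A \in unitmx -> cramer_inv A = invmx A.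
Proof. by rewrite /invmx => ->. Qed.

(** * Entrywise convergence of matrices along a filter *)

Section MatrixConvergence.
Variables (K : numFieldType) (T : Type) (F : set_system T).
Context {FF : Filter F}.

(** Taken entrywise, so that limits of determinants and adjugates, which are polynomial in the
    entries, reduce to sums and products of scalars. *)
Definition cvgmx p q (f : T -> 'M[K]_(p, q)) (A : 'M[K]_(p, q)) :=
  forall i j, f t i j @[t --> F] --> A i j.

Lemma cvgmx_cst p q (A : 'M[K]_(p, q)) : cvgmx (fun=> A) A.
Proof. by move=> i j; exact: cvg_cst. Qed.

Lemma cvgmxD p q (f g : T -> 'M[K]_(p, q)) A B :
  cvgmx f A -> cvgmx g B -> cvgmx (fun t => f t + g t) (A + B).
Proof.
move=> fA gB i j; under eq_fun do rewrite mxE.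
by rewrite mxE; apply: cvgD; [exact: fA|exact: gB].
Qed.

Lemma cvgmxB p q (f g : T -> 'M[K]_(p, q)) A B :
  cvgmx f A -> cvgmx g B -> cvgmx (fun t => f t - g t) (A - B).
Proof.
move=> fA gB i j; under eq_fun do rewrite !mxE.
by rewrite !mxE; apply: cvgB; [exact: fA|exact: gB].
Qed.

Lemma cvgmxZ p q (c : T -> K) (f : T -> 'M[K]_(p, q)) (a : K) A :
  c @ F --> a -> cvgmx f A -> cvgmx (fun t => c t *: f t) (a *: A).
Proof.
move=> ca fA i j; under eq_fun do rewrite mxE.
by rewrite mxE; apply: cvgM => //; exact: fA.
Qed.

Lemma cvgmxM p q r (f : T -> 'M[K]_(p, q)) (g : T -> 'M[K]_(q, r)) A B :
  cvgmx f A -> cvgmx g B -> cvgmx (fun t => f t *m g t) (A *m B).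
Proof.
move=> fA gB i j; under eq_fun do rewrite mxE.
rewrite mxE; apply: cvg_big => [x|k _]; first exact: add_continuous.
by apply: cvgM; [exact: fA|exact: gB].
Qed.

Lemma cvgmx_ulsub p q p' q' (f : T -> 'M[K]_(p + p', q + q')) A :
  cvgmx f A -> cvgmx (fun t => ulsubmx (f t)) (ulsubmx A).
Proof. by move=> fA i j; under eq_fun do rewrite !mxE; rewrite !mxE; exact: fA. Qed.

Lemma cvgmx_ursub p q p' q' (f : T -> 'M[K]_(p + p', q + q')) A :
  cvgmx f A -> cvgmx (fun t => ursubmx (f t)) (ursubmx A).
Proof. by move=> fA i j; under eq_fun do rewrite !mxE; rewrite !mxE; exact: fA. Qed.

Lemma cvgmx_dlsub p q p' q' (f : T -> 'M[K]_(p + p', q + q')) A :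
  cvgmx f A -> cvgmx (fun t => dlsubmx (f t)) (dlsubmx A).
Proof. by move=> fA i j; under eq_fun do rewrite !mxE; rewrite !mxE; exact: fA. Qed.

Lemma cvgmx_drsub p q p' q' (f : T -> 'M[K]_(p + p', q + q')) A :
  cvgmx f A -> cvgmx (fun t => drsubmx (f t)) (drsubmx A).
Proof. by move=> fA i j; under eq_fun do rewrite !mxE; rewrite !mxE; exact: fA. Qed.

Lemma cvg_det p (f : T -> 'M[K]_p) A : cvgmx f A -> \det (f t) @[t --> F] --> \det A.
Proof.
move=> fA; rewrite /determinant.
apply: cvg_big => [x|s _]; first exact: add_continuous.
apply: cvgM; first exact: cvg_cst.
by apply: cvg_big => [x|i _]; [exact: mul_continuous|exact: fA].
Qed.

Lemma cvgmx_adj p (f : T -> 'M[K]_p) A : cvgmx f A -> cvgmx (fun t => \adj (f t)) (\adj A).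
Proof.
move=> fA i j; under eq_fun do rewrite mxE; rewrite mxE /cofactor.
apply: cvgM; first exact: cvg_cst.
apply: cvg_det => k l; under eq_fun do rewrite !mxE.
by rewrite !mxE; exact: fA.
Qed.

Lemma cvgmx_cramer_inv p (f : T -> 'M[K]_p) A : A \in unitmx -> cvgmx f A ->
  cvgmx (fun t => cramer_inv (f t)) (cramer_inv A).
Proof.
move=> Au fA; apply: cvgmxZ; last exact: cvgmx_adj.
by apply: cvgV; [rewrite -unitfE -unitmxE|exact: cvg_det].
Qed.

End MatrixConvergence.

(** * Continuity of the argument at accretive matrices *)

Section ArgumentConvergence.
Variables (R : realType) (T : Type) (F : set_system T).
Context {FF : Filter F}.
Local Notation C := R[i].

Lemma cvg_Re (f : T -> C^o) (a : C^o) :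
  f @ F --> a -> complex.Re (f t) @[t --> F] --> complex.Re a.
Proof.
move=> /cvgrPdist_lt fa; apply/cvgrPdist_lt => e e0.
have /fa : 0 < e%:C by rewrite ltcR.
apply: filterS => t; rewrite -ltcR; apply: le_lt_trans.
by apply: le_trans (normc_ge_Re _); rewrite lecR; case: (a) (f t) => [? ?] [].
Qed.

Lemma cvg_Im (f : T -> C^o) (a : C^o) :
  f @ F --> a -> complex.Im (f t) @[t --> F] --> complex.Im a.
Proof.
move=> /cvgrPdist_lt fa; apply/cvgrPdist_lt => e e0.
have /fa : 0 < e%:C by rewrite ltcR.
apply: filterS => t; rewrite -ltcR; apply: le_lt_trans.
(* The imaginary part of [w] is, up to sign, the real part of [w i], and [w i] has the modulus of
   [w]. *)
have i1 : `|'i%C : C| = 1 by rewrite normc_def /= expr0n expr1n add0r sqrtr1.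
rewrite -[leRHS]mulr1 -i1 -normrM; apply: le_trans (normc_ge_Re _).
by rewrite ReiNIm normrN lecR; case: (a) (f t) => [? ?] [].
Qed.

Lemma cvg_half_plane_arg (f : T -> C^o) (a : C^o) : 0 < complex.Re a ->
  f @ F --> a -> half_plane_arg (f t) @[t --> F] --> half_plane_arg a.
Proof.
move=> a0 fa.
apply: (@continuous_cvg _ _ _ F _ _ atan); first exact: continuous_atan.
apply: cvgM; first exact: cvg_Im.
by apply: cvgV; [rewrite gt_eqF|exact: cvg_Re].
Qed.

(** At each elimination step the pivot of the limit lies in the open right half-plane, where
    inversion and the arctangent of the slope are continuous. Accretivity is asked of the limit
    alone, so the approximating matrices may be arbitrary. *)
Lemma cvg_accretive_arg n (f : T -> 'M[C]_n) A : accretive A ->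
  cvgmx F f A -> accretive_arg (f t) @[t --> F] --> accretive_arg A.
Proof.
elim: n f A => [|n IH] f A Aacc fA; first exact: cvg_cst.
apply: cvgD.
  by apply: cvg_half_plane_arg; [exact: accretive_pivot|exact: fA].
apply: IH; first exact: accretive_schur.
apply: cvgmxB; first exact: cvgmx_drsub.
apply: cvgmxZ; first by apply: cvgV; [exact: accretive_pivot_neq0|exact: fA].
by apply: cvgmxM; [exact: cvgmx_dlsub|exact: cvgmx_ursub].
Qed.

End ArgumentConvergence.

(** * The cocycle on the group and its value on the section *)

Section GuichardetWignerCocycle.
Variables (R : realType) (n m : nat).
Local Notation C := R[i].
Local Notation SU := (@SU R n m).

(** The matrix [1 + W Y]. Writing it with [cramer_inv] gives a rational expression in the entries,
    suited to limits taken over all nearby pairs of matrices. *)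
Definition block_ratio (g1 g2 : 'M[C]_(n + m)) : 'M[C]_n :=
  1%:M + (cramer_inv (ulsubmx g1) *m ursubmx g1) *m
         (dlsubmx g2 *m cramer_inv (ulsubmx g2)).

Lemma block_ratioE g1 g2 : SU g1 -> SU g2 ->
  block_ratio g1 g2 = 1%:M + (invmx (ulsubmx g1) *m ursubmx g1) *m
                             (dlsubmx g2 *m invmx (ulsubmx g2)).
Proof. by move=> /SU_ul_unit u1 /SU_ul_unit u2; rewrite /block_ratio !cramer_invE. Qed.

Lemma accretive_block_ratio g1 g2 : SU g1 -> SU g2 -> accretive (block_ratio g1 g2).
Proof.
move=> s1 s2; rewrite block_ratioE //; apply: accretive_contractions.
  exact: SU_contraction_ur.
exact: SU_contraction_dl.
Qed.

(** The upper left block of [g1 g2] factors as [a1 a2 + b1 c2 = a1 (1 + a1^-1 b1 c2 a2^-1) a2]. *)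
Lemma vdet_cocycle g1 g2 : SU g1 -> SU g2 ->
  vdet g1 * vdet g2 * (vdet (g1 *m g2))^-1 = (\det (block_ratio g1 g2))^-1.
Proof.
move=> s1 s2; have u1 := SU_ul_unit s1; have u2 := SU_ul_unit s2.
have -> : vdet (g1 *m g2) = vdet g1 * \det (block_ratio g1 g2) * vdet g2.
  rewrite /vdet -!det_mulmx block_ratioE // mulmxDr mulmxDl mulmx1; congr determinant.
  rewrite -{1}[g1]submxK -{1}[g2]submxK mulmx_block block_mxKul; congr (_ + _).
  by rewrite !mulmxA (mulmxV u1) mul1mx (mulmxKV u2).
have := accretive_det_neq0 (accretive_block_ratio s1 s2).
move: u1 u2; rewrite !unitmxE !unitfE -!/(vdet _).
by move: (vdet g1) (vdet g2) (\det _) => x y d x0 y0 d0; field; rewrite x0 y0 d0.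
Qed.

Lemma is_continuous_arg_exists : exists theta, @is_continuous_arg R n m theta.
Proof.
(* The minus sign appears because the quotient of the values of [v] is the inverse of
   [det (block_ratio g1 g2)]. *)
exists (fun g => - accretive_arg (block_ratio g.1 g.2)); split.
(* Continuity is proved in the space of all pairs of matrices, at each point of [SU * SU]; this
   implies continuity on the subspace. *)
- apply: continuous_in_subspaceT => -[g1 g2]; rewrite inE => -[/= s1 s2].
  apply: cvgN; apply: cvg_accretive_arg; first exact: accretive_block_ratio.
  have c1 : cvgmx (nbhs (g1, g2)) (fun g : 'M[C]_(n + m) * 'M[C]_(n + m) => g.1) g1.
    move=> i j; apply: (cvg_comp _ (fun M : 'M[C]_(n + m) => M i j)).
      exact: cvg_fst.
    exact: coord_continuous.
  have c2 : cvgmx (nbhs (g1, g2)) (fun g : 'M[C]_(n + m) * 'M[C]_(n + m) => g.2) g2.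
    move=> i j; apply: (cvg_comp _ (fun M : 'M[C]_(n + m) => M i j)).
      exact: cvg_snd.
    exact: coord_continuous.
  apply: cvgmxD; first exact: cvgmx_cst.
  apply: cvgmxM; apply: cvgmxM.
  + exact: (cvgmx_cramer_inv (SU_ul_unit s1) (cvgmx_ulsub c1)).
  + exact: (cvgmx_ursub c1).
  + exact: (cvgmx_dlsub c2).
  + exact: (cvgmx_cramer_inv (SU_ul_unit s2) (cvgmx_ulsub c2)).
- have -> : block_ratio 1%:M 1%:M = 1%:M.
    rewrite block_ratioE; try exact: SU1.
    by rewrite scalar_mx_block block_mxKur block_mxKdl mulmx0 !mul0mx addr0.
  by rewrite accretive_arg1 oppr0.
- move=> g1 g2 s1 s2 /=; rewrite vdet_cocycle // expiN normfV -invfM.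
  by rewrite -accretive_argP //; exact: accretive_block_ratio.
Qed.

End GuichardetWignerCocycle.

Theorem mainTheorem3 (R : realType) (n m : nat) (hn : (0 < n)%N) (hm : (0 < m)%N)
    (Z1 Z2 : 'M[R[i]]_(n, m))
    (hZ1 : posdefmx (1%:M - Z1 *m Z1^t*))
    (hZ2 : posdefmx (1%:M - Z2 *m Z2^t*)) :
  mult_factor Z1 Z2 = expi (- (2 * pi * GW_cocycle (sigmx Z1) (sigmx Z2))).
Proof.
have s1 := sigmx_SU hZ1; have s2 := sigmx_SU hZ2.
(* Since a determination exists, [xget] does not return its default value, and the polar identity
   holds for the chosen function at the pair of sections. *)
have [_ _ /(_ _ _ s1 s2) /=] :=
  xgetPex (fun=> 0) (@is_continuous_arg_exists R n m).
rewrite vdet_cocycle // -/(continuous_arg _).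
have w0 := accretive_det_neq0 (accretive_block_ratio s1 s2).
rewrite block_ratioE // sigmx_ulV_ur // sigmx_dl_ulV // in w0 *.
rewrite /GW_cocycle mulVKf ?mulf_neq0 ?pnatr_eq0 ?gt_eqF ?pi_gt0 //.
rewrite /mult_factor; set w := \det _ in w0 *; set theta := continuous_arg _.
(* The identity [E] says [w^-1 = |w|^-1 * expi theta]; inverting [w^-1 * |w|] turns it into
   [w / |w| = (expi theta)^-1]. *)
rewrite expiN normfV => E; rewrite -[LHS]invrK invfM invrK E.
by rewrite mulrAC mulVf ?mul1r // normr_eq0.
Qed.
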